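(* Let $X$ and $Y$ be cellular spaces with $X$ compact, and let $a,b\colon X\to Y$ be based maps such that $a$ is $1$-similar to $b$ ($a\overset{1}{\sim}b$). Then $a$ is strongly $1$-similar to $b$ ($a\overset{1}{\approx}b$).
   Context: Conventions: a cellular space is a based CW complex; spaces and maps are based unless called unbased. For a set $W$, $\langle W\rangle$ is the free abelian group with basis $\{\langle w\rangle: w\in W\}$ (its elements are called ensembles); a function $f$ induces the homomorphism $\langle f\rangle$. For spaces $X,Y$ with $X$ compact Hausdorff, $Y^X$ is the space (compact-open topology) of based maps $X\to Y$, based at the constant map; $Y^X_a$ is the path component of $a$. For $R\subseteq X$ containing the basepoint, $V\mapsto V|_R$ denotes the homomorphism $\langle Y^X\rangle\to\langle Y^R\rangle$ induced by restriction. $\mathcal F_n(X)$ is the set of finite subsets $R\subseteq X$ containing the basepoint with $|R|\le n+1$. For $s\ge0$, $\langle Y^X\rangle^{(s)}$ is the subgroup of those $V\in\langle Y^X\rangle$ with $V|_R=0$ for all $R\in\mathcal F_{s-1}(X)$. $r$-similarity: $a\overset{r}{\sim}b$ iff there is $A\in\langle Y^X_a\rangle$ with $\langle b\rangle-A\in\langle Y^X\rangle^{(r+1)}$. Strong similarity: for unbased spaces $U,V$, $V^{(U)}$ is the space of unbased maps $U\to V$ and $\Xi^U\colon V\to V^{(U)}$ sends $v$ to the constant map at $v$. If $U=\coprod_{i\in(m)}U_i$ (disjoint union, $(m)=\{1,\dots,m\}$, $m\ge 0$), the combining product $\boxed{\sqcup}\colon\prod_i\langle V^{(U_i)}\rangle\to\langle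 V^{(U)}\rangle$ is the $\mathbb Z$-multilinear map with $\boxed{\sqcup}_i\langle w_i\rangle=\langle w\rangle$, $w|_{U_i}=w_i$. For a nonempty finite set $E$, $\Delta E$ is the simplex spanned by $E$, and $\Delta F\subseteq\Delta E$ is the face for nonempty $F\subseteq E$. A layout is a set $A$ of pairwise disjoint nonempty subsets of $E$; put $\Delta[A]=\coprod_{F\in A}\Delta F\subseteq\Delta E$. An ensemble $S\in\langle V^{(\Delta E)}\rangle$ is fissile if $S|_{\Delta[A]}=\boxed{\sqcup}_{F\in A}S|_{\Delta F}$ in $\langle V^{(\Delta[A])}\rangle$ for every layout $A$. For an unbased space $U$ and compact Hausdorff $X$ with basepoint $x_0$, let $U\wr X=(U\times X)/(U\times\{x_0\})$ (based at the collapsed set), and let $\#^X\colon (Y^X)^{(U)}\to Y^{U\wr X}$ be the bijection $\#^X(w)(u\wr x)=w(u)(x)$; put $\langle (Y^X)^{(U)}\rangle^{(s)}_X=\langle\#^X\rangle^{-1}(\langle Y^{U\wr X}\rangle^{(s)})$. For cellular $X,Y$, $X$ compact, $r\ge0$: $a\overset{r}{\approx}b$ iff for every nonempty finite set $E$ there is a fissile $S\in\langle (Y^X_a)^{(\Delta E)}\rangle\subseteq\langle (Y^X)^{(\Delta E)}\rangle$ with $\langle\Xi^{\Delta E}(b)\rangle-S\in\langle (Y^X)^{(\Delta E)}\rangle^{(r+1)}_X$. *)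

(* Defs.v *)
From HB Require Import structures.
From mathcomp Require Import all_boot all_order all_algebra.
From mathcomp Require Import all_classical all_reals all_analysis.
From mathcomp Require Import Rstruct Rstruct_topology.

Set Implicit Arguments.
Unset Strict Implicit.
Unset Printing Implicit Defensive.

Import Order.TTheory GRing.Theory Num.Theory.
Local Open Scope classical_set_scope.
Local Open Scope ring_scope.

Definition RR : realType := Rdefinitions.R.

(* The closed n-disk, modelled (up to homeomorphism) by the cube [-1,1]^n,
   and its interior (-1,1)^n. *)
Definition cube (n : nat) : set 'rV[RR]_n :=
  [set v | forall i, -1 <= v ord0 i <= 1].
Definition ocube (n : nat) : set 'rV[RR]_n :=
  [set v | forall i, -1 < v ord0 i < 1].
Arguments cube : clear implicits.
Arguments ocube : clear implicits.

Definition CW_structure (X : topologicalType) (I : nat -> Type)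
    (Phi : forall n, I n -> 'rV[RR]_n -> X) : Prop :=
  let cell (n : nat) (i : I n) : set X := image (ocube n) (Phi n i) in
  hausdorff_space X /\
  (forall n (i : I n), {within cube n, continuous (Phi n i)}) /\
      (forall n (i : I n) u v, ocube n u -> ocube n v ->
          Phi n i u = Phi n i v -> u = v) /\
      (forall x : X, exists n (i : I n), cell n i x) /\
      (forall x n (i : I n) m (j : I m), cell n i x -> cell m j x ->
          existT I n i = existT I m j) /\
      (forall n (i : I n) v, cube n v -> ~ ocube n v ->
          exists m (j : I m), (m < n)%N /\ cell m j (Phi n i v)) /\
      (forall n (i : I n), exists (k : nat) (c : 'I_k -> {m : nat & I m}),
          forall v, cube n v -> exists l : 'I_k,
            cell (projT1 (c l)) (projT2 (c l)) (Phi n i v)) /\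
      (forall A : set X,
          closed A <-> forall n (i : I n), closed (cube n `&` Phi n i @^-1` A)).

Definition cellular (X : topologicalType) (x0 : X) : Prop :=
  exists (I : nat -> Type) (Phi : forall n, I n -> 'rV[RR]_n -> X),
    CW_structure Phi /\ exists i : I 0%N, image (ocube 0) (Phi 0%N i) x0.

(* Ensembles: elements of the free abelian group <W>, as finitely       *)
(* supported coefficient functions W -> int.                           *)

Definition supp (W : Type) (V : W -> int) : set W := [set w | V w != 0].
Definition ens (W : Type) (V : W -> int) : Prop := finite_set (supp V).
Definition basis (W : choiceType) (w : W) : W -> int :=
  fun v => if v == w then 1 else 0.
Definition push (W W' : choiceType) (f : W -> W') (V : W -> int) : W' -> int :=
  fun w' => (\sum_(w \in [set w | f w = w']) V w)%R.

Definition card_le (T : Type) (Rs : set T) (s : nat) : Prop :=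
  exists f : 'I_s -> T, Rs `<=` range f.

Section Spaces.
Context (X Y : topologicalType) (x0 : X) (y0 : Y).

Definition based_maps : set (X -> Y) :=
  [set f | continuous f /\ f x0 = y0].

Definition path_comp (a : X -> Y) : set (X -> Y) :=
  [set b | exists g : RR -> {compact-open, X -> Y},
     {within [set t : RR | 0 <= t <= 1], continuous g} /\
     g 0 = a /\ g 1 = b /\
     (forall t : RR, 0 <= t <= 1 -> based_maps (g t))].

(* restriction Y^X -> Y^R; a based map R -> Y is represented by its
   extension by the basepoint y0 outside R *)
Definition restr (Rs : set X) (f : X -> Y) : X -> Y :=
  fun x => if `[< Rs x >] then f x else y0.

(* F_n(X) (with n = s - 1): finite R containing x0 with |R| <= s *)
Definition Fset (s : nat) (Rs : set X) : Prop := Rs x0 /\ card_le Rs s.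

Definition filt (s : nat) (V : (X -> Y) -> int) : Prop :=
  forall Rs, Fset s Rs -> push (restr Rs) V = fun _ => 0.

Definition rsim (r : nat) (a b : X -> Y) : Prop :=
  exists A : (X -> Y) -> int,
    [/\ ens A, supp A `<=` path_comp a &
        filt r.+1 (fun f => basis b f - A f)].

Section Simplex.
Context (E : finType).

Definition Pt := {ptws E -> RR}.
Definition pt0 : Pt := fun _ => 0.

Definition simplex (F : {set E}) : set Pt :=
  [set t | (forall e, 0 <= t e) /\ (forall e, e \notin F -> t e = 0) /\
           \sum_(e : E) t e = 1].

(* V^(U) for U a subset of the simplex and V a subset of Y^X: unbased
   continuous maps U -> V (for the compact-open topology on Y^X),
   represented by their extension by the constant map y0 outside U *)
Definition cst0 : X -> Y := fun _ => y0.
Definition unb_maps (U : set Pt) (Vs : set (X -> Y)) : set (Pt -> (X -> Y)) :=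
  [set w | {within U, continuous (w : Pt -> {compact-open, X -> Y})} /\
           w @` U `<=` Vs /\ (forall t, ~ U t -> w t = cst0)].

Definition restrU (U' : set Pt) (w : Pt -> (X -> Y)) : Pt -> (X -> Y) :=
  fun t => if `[< U' t >] then w t else cst0.

Definition Xi (b : X -> Y) : Pt -> (X -> Y) := restrU (simplex [set: E]%SET) (fun _ => b).

Definition layout (A : {set {set E}}) : Prop :=
  (@finset.set0 E) \notin A /\
  (forall F G, F \in A -> G \in A -> F != G -> forall e, e \in F -> e \notin G).
Definition DeltaL (A : {set {set E}}) : set Pt :=
  [set t | exists2 F, F \in A & simplex F t].

Definition glue (A : {set {set E}}) (tau : {set E} -> (Pt -> (X -> Y)))
    : Pt -> (X -> Y) :=
  fun t => match [pick F in A | `[< simplex F t >]] with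
           | Some F => tau F t
           | None => cst0
           end.

(* the combining product: the Z-multilinear extension of gluing *)
Definition combine (A : {set {set E}}) (V : {set E} -> (Pt -> (X -> Y)) -> int)
    : (Pt -> (X -> Y)) -> int :=
  fun w => (\sum_(tau \in [set tau | (forall F, F \notin A -> tau F = fun _ => cst0)
                                     /\ glue A tau = w])
              \prod_(F in A) V F (tau F))%R.

Definition fissile (S : (Pt -> (X -> Y)) -> int) : Prop :=
  forall A, layout A ->
    push (restrU (DeltaL A)) S = combine A (fun F => push (restrU (simplex F)) S).

(* the wreath set  U wr X = (U x X)/(U x {x0}),  U = Delta E;
   its points are the equivalence classes, subsets of Pt * X *)
Definition wr_class (p : Pt * X) : set (Pt * X) :=
  if `[< p.2 = x0 >] then simplex [set: E]%SET `*` [set x0] else [set p].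
Definition wr_pts : set (set (Pt * X)) :=
  [set wr_class p | p in simplex [set: E]%SET `*` [set: X]].
Definition wr_base : set (Pt * X) := simplex [set: E]%SET `*` [set x0].

(* #^X : (Y^X)^(U) -> Y^(U wr X),  #(w)(u wr x) = w(u)(x) *)
Definition sharp (w : Pt -> (X -> Y)) : set (Pt * X) -> Y :=
  fun C => let p := xget (pt0, x0) C in w p.1 p.2.

Definition restr_wr (Rs : set (set (Pt * X))) (f : set (Pt * X) -> Y)
    : set (Pt * X) -> Y :=
  fun C => if `[< Rs C >] then f C else y0.

(* <(Y^X)^(Delta E)>^(s)_X = <#>^{-1} (<Y^(Delta E wr X)>^(s)) *)
Definition filt_wr (s : nat) (V : (Pt -> (X -> Y)) -> int) : Prop :=
  forall Rs, Rs `<=` wr_pts -> Rs wr_base -> card_le Rs s ->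
    push (fun w => restr_wr Rs (sharp w)) V = fun _ => 0.

End Simplex.

Definition strong_sim (r : nat) (a b : X -> Y) : Prop :=
  forall E : finType, (0 < #|E|)%N ->
    exists S : (Pt E -> (X -> Y)) -> int,
      [/\ ens S, supp S `<=` unb_maps (simplex [set: E]%SET) (path_comp a),
          fissile S &
          filt_wr r.+1 (fun w => basis (Xi b) w - S w)].

End Spaces.

(* Main.v *)
Require Import Defs.
From HB Require Import structures.
From mathcomp Require Import all_boot all_order all_algebra.
From mathcomp Require Import all_classical all_reals all_analysis.
From mathcomp Require Import Rstruct Rstruct_topology.

(** Write the given ensemble as [\sum_i eps i <w i>] with [eps i = 1] or [-1],
    repeating maps if necessary, so that [\sum_i eps i = 1], and choose paths
    [H i] in Y^X from [a] to [w i].  For r = 1 only the values at single points (t, x)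
    matter, so it suffices to find a fissile ensemble of maps from the simplex
    to the star-shaped tree formed by the paths whose evaluation at every [t]
    is [\sum_i eps i <H i 1>].

    Colour every nonempty face [B] of the simplex independently by some
    [j B : I], with signed weight [eps (j B)].  A colouring determines a map to
    the tree: it sits at the leaf [i] on a face [L] all of whose subfaces have
    colour [i], and retracts towards the root away from such faces.  On a face
    [F] this map depends only on the colours of the subfaces of [F]; disjoint
    faces share no subface, and independence of the colours is fissility.  A
    face [L] with [m > 0] vertices is monochrome of colour [i] with total weight
    [eps i ^+ (2 ^ m - 1) = eps i], whatever [L] is; hence at a given point all
    the intermediate positions on the branch [i] have total weight 0 and the
    leaf [i] has total weight [eps i]. *)

Set Implicit Arguments.
Unset Strict Implicit.
Unset Printing Implicit Defensive.

Import Order.TTheory GRing.Theory Num.Theory.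
Local Open Scope classical_set_scope.
Local Open Scope ring_scope.

(** * Signed weights on colourings and their independence *)

(** Grouping the indices by the value of [f], each value contributes its total coefficient times
    [K]. *)
Lemma sum_fibers_eq0 (J : finType) (T : eqType) (c : J -> int) (f : J -> T)
    (K : T -> int) :
  (forall j0, K (f j0) != 0 -> \sum_(j | f j == f j0) c j = 0) ->
  \sum_j c j * K (f j) = 0.
Proof.
move=> H.
pose s := undup [seq f j | j <- enum J].
have -> : \sum_j c j * K (f j) =
    \sum_j \sum_(v <- s) (if f j == v then c j * K v else 0).
  apply: eq_bigr => j _.
  have js : f j \in s by rewrite mem_undup map_f // mem_enum.
  rewrite (bigD1_seq (f j)) ?undup_uniq //=.
  rewrite eqxx big1 ?addr0 // => v /negPf.
  by rewrite eq_sym => ->.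
rewrite exchange_big /= big_seq big1 // => v.
rewrite mem_undup => /mapP[j0 _ ->].
rewrite -big_mkcond /= -big_distrl /=.
by have [->|/H ->] := eqVneq (K (f j0)) 0; rewrite ?mulr0 ?mul0r.
Qed.

Section ProductWeight.
Variables (Q I : finType) (eps : I -> int).
Hypothesis eps_sum1 : \sum_i eps i = 1.

Definition weight (j : {ffun Q -> I}) : int := \prod_q eps (j q).

Lemma weight_sum1 : \sum_j weight j = 1.
Proof.
rewrite /weight -(bigA_distr_bigA (fun _ : Q => eps)) /=.
by rewrite big1.
Qed.

(* Exchanging the coordinates in [P] between two samples preserves the joint
   weight. *)
Lemma weight_indep (P : pred Q) (f g : {ffun Q -> I} -> int) :
  (forall j j' : {ffun Q -> I}, {in P, j =1 j'} -> f j = f j') ->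
  (forall j j' : {ffun Q -> I}, {in predC P, j =1 j'} -> g j = g j') ->
  \sum_j weight j * (f j * g j) =
  (\sum_j weight j * f j) * (\sum_j weight j * g j).
Proof.
move=> Hf Hg.
pose mix (p : {ffun Q -> I} * {ffun Q -> I}) : {ffun Q -> I} :=
  [ffun q => if P q then p.1 q else p.2 q].
pose h p := (mix p, mix (p.2, p.1)).
have hK : involutive h.
  move=> [j j']; rewrite /h /mix /=; congr pair; apply/ffunP => q;
  by rewrite !ffunE /= ?ffunE /=; case: (P q).
rewrite big_distrlr /= pair_big /=.
rewrite -[LHS]mulr1 -weight_sum1 big_distrlr /= pair_big /=.
rewrite [RHS](reindex_inj (inv_inj hK)) /=; apply: eq_bigr => -[j j'] _ /=.
have -> : f (mix (j, j')) = f j.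
  by apply: Hf => q Pq; rewrite /mix ffunE (Pq : P q).
have -> : g (mix (j', j)) = g j.
  by apply: Hg => q Pq; rewrite /mix ffunE (negPf (Pq : ~~ P q)).
have E : weight (mix (j, j')) * weight (mix (j', j)) = weight j * weight j'.
  rewrite /weight -!big_split /=; apply: eq_bigr => q _.
  by rewrite !ffunE; case: (P q) => //=; rewrite mulrC.
by rewrite [RHS]mulrACA E mulrAC.
Qed.

(** Induction on [s]: the product over the tail ignores the coordinates in [P x], so [weight_indep]
    splits off the factor of [x]. *)
Lemma weight_indep_prod (T : eqType) (s : seq T) (P : T -> pred Q)
    (g : T -> {ffun Q -> I} -> int) :
  uniq s ->
  {in s &, forall x y, x != y -> forall q, P x q -> ~~ P y q} ->
  (forall x (j j' : {ffun Q -> I}), {in P x, j =1 j'} -> g x j = g x j') ->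
  \sum_j weight j * (\prod_(x <- s) g x j) =
  \prod_(x <- s) \sum_j weight j * g x j.
Proof.
move=> us dP Hg; elim: s us dP => [|x s IH] /=.
  move=> _ _; rewrite big_nil -[RHS]weight_sum1.
  by apply: eq_bigr => j _; rewrite big_nil mulr1.
move=> /andP[xs us] dP.
rewrite big_cons -IH //; last first.
  by move=> y z ys zs; apply: dP; rewrite inE ?ys ?zs orbT.
rewrite -(@weight_indep (P x)) => [|j j'|j j' jj'].
- by apply: eq_bigr => j _; rewrite big_cons.
- exact: Hg.
- apply: eq_big_seq => y ys; apply: Hg => q Pyq; apply: jj'.
  apply: (dP y x) => //; rewrite ?mem_head ?inE ?ys ?orbT //.
  by apply: contraNneq xs => <-.
Qed.

(** The sum factors over coordinates: each [q] outside [P] gives the total 1, each [q] in [P] gives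
    [eps i], and an odd power of [eps i] is [eps i]. *)
Lemma weight_constant (P : {set Q}) (i : I) :
  eps i ^+ 2 = 1 -> odd #|P| ->
  \sum_j weight j * [forall q in P, j q == i]%:Z = eps i.
Proof.
move=> e2 oP.
pose F (q : Q) (v : I) : int := eps v * ((q \in P) ==> (v == i))%:Z.
transitivity (\sum_(j : {ffun Q -> I}) \prod_q F q (j q)).
  apply: eq_bigr => j _; rewrite big_split /=; congr (_ * _).
  have [/forall_inP H|] := boolP [forall q in P, j q == i].
    by rewrite big1 // => q _; have := H q; case: (q \in P) => //= ->.
  rewrite negb_forall => /existsP[q]; rewrite negb_imply => /andP[qP jq].
  by rewrite (bigD1 q) //= qP (negPf jq) /= mul0r.
rewrite -(bigA_distr_bigA F) /= (bigID (mem P)) /=.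
rewrite [X in _ * X]big1 ?mulr1 => [|q /negPf qP]; last first.
  by rewrite -[RHS]eps_sum1; apply: eq_bigr => v _; rewrite /F qP mulr1.
rewrite (eq_bigr (fun _ => eps i)) => [|q qP]; last first.
  rewrite (bigD1 i) //= /F qP eqxx mulr1 big1 ?addr0 // => v /negPf -> /=.
  by rewrite mulr0.
rewrite big_const iter_mulr_1.
by rewrite -(odd_double_half #|P|) oP /= add1n exprS -mul2n exprM e2 expr1n mulr1.
Qed.

End ProductWeight.

(** * Height of a point of the simplex along each branch *)

Lemma continuous_bigmax (T : topologicalType) (K : Type) (r : seq K) (P : pred K)
    (f : K -> T -> RR) (c : RR) :
  (forall k, continuous (f k)) ->
  continuous (fun x => \big[Num.max/c]_(k <- r | P k) f k x).
Proof.
move=> cf; elim: r => [|k r IH].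
  by under eq_fun do rewrite big_nil; exact: cst_continuous.
under eq_fun do rewrite big_cons.
by case: (P k) => // x; exact: (@continuous_max RR T _ _ x (cf k x) (IH x)).
Qed.

Lemma continuous_bigmin (T : topologicalType) (K : Type) (r : seq K) (P : pred K)
    (f : K -> T -> RR) (c : RR) :
  (forall k, continuous (f k)) ->
  continuous (fun x => \big[Num.min/c]_(k <- r | P k) f k x).
Proof.
move=> cf; elim: r => [|k r IH].
  by under eq_fun do rewrite big_nil; exact: cst_continuous.
under eq_fun do rewrite big_cons.
by case: (P k) => // x; exact: (@continuous_min RR T _ _ x (cf k x) (IH x)).
Qed.

Section Height.
Variables (E I : finType).
Implicit Types (j : {ffun {set E} -> I}) (i : I) (L F : {set E}) (t : Pt E).

Definition faces L : {set {set E}} := (powerset L :\ finset.set0)%SET.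

Lemma mem_faces L B : (B \in faces L) = (B != finset.set0) && (B \subset L).
Proof. by rewrite in_setD1 powersetE. Qed.

Lemma odd_card_faces L : L != finset.set0 -> odd #|faces L|.
Proof.
move=> L0; have := cardsD1 finset.set0 (powerset L).
rewrite powersetE finset.sub0set card_powerset add1n => E2.
have : odd (2 ^ #|L|) = ~~ odd #|faces L| by rewrite E2.
by rewrite oddX /= cards_eq0 (negPf L0) /= => /esym/negbFE.
Qed.

Definition monochrome j i L := [forall B in faces L, j B == i].

Lemma monochromeS j i L L' :
  L' \subset L -> monochrome j i L -> monochrome j i L'.
Proof.
move=> LL /forall_inP H; apply/forall_inP => B; rewrite mem_faces => /andP[B0 BL].
by apply: H; rewrite mem_faces B0 (fintype.subset_trans BL).
Qed.

Lemma monochrome_color j i L :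
  L != finset.set0 -> monochrome j i L -> i = j L.
Proof.
by move=> L0 /forall_inP H; apply/esym/eqP/H; rewrite mem_faces L0 fintype.subxx.
Qed.

(* On the simplex it vanishes at every largest coordinate, which is at least
   [1 / #|E|]. *)
Definition slack t (e : E) : RR := Num.max 0 (1 - #|E|%:R * t e).

(** Position on branch [i], with 0 the root and 1 the leaf; a point of a face monochrome of colour
    [i] has slack 1 at every vertex outside it, hence height 1. *)
Definition height j i t : RR :=
  \big[Num.max/0]_(L | (L != finset.set0) && monochrome j i L)
    \big[Num.min/1]_(e | e \notin L) slack t e.

(** For [0 < s <= 1] these are the vertices with coordinate above [(1 - s) / #|E|]: the smallest [L]
    that can witness height at least [s]. *)
Definition core t (s : RR) : {set E} := [set e | slack t e < s]%SET.

(** The coordinates sum to 1, so one of them is at least [1 / #|E|] and has slack 0. *)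
Lemma core_neq0 t s :
  simplex [set: E]%SET t -> 0 < s -> core t s != finset.set0.
Proof.
move=> [t0 [_ t1]] s0; apply/negP => /eqP/setP H.
have H' e : #|E|%:R * t e < 1.
  have := H e; rewrite !inE => /negbT; rewrite -leNgt => /(lt_le_trans s0).
  by rewrite /slack lt_max ltxx /= subr_gt0.
have E0 : (0 < #|E|)%N.
  rewrite lt0n; apply/negP => /eqP/card0_eq E0.
  by move: t1; rewrite big_pred0 // => /eqP; rewrite eq_sym oner_eq0.
have : \sum_(e : E) #|E|%:R * t e < \sum_(e : E) (1 : RR).
  have /card_gt0P[e0 _] := E0.
  rewrite (bigD1 e0) //= [ltRHS](bigD1 e0) //=.
  by rewrite ltr_leD // ler_sum // => e _; apply: ltW.
by rewrite -big_distrr /= t1 mulr1 sumr_const ltxx.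
Qed.

Lemma height_ge0 j i t : 0 <= height j i t.
Proof. by apply/bigmax_geP; left. Qed.

Lemma height_le1 j i t : height j i t <= 1.
Proof.
apply/bigmax_leP; split=> [|L _]; first exact: ler01.
by apply/bigmin_leP; left.
Qed.

Lemma height_eq0 j t : ~ (exists i, 0 < height j i t) ->
  forall i, height j i t = 0.
Proof.
move=> h i; apply/le_anti; rewrite height_ge0 andbT leNgt; apply/negP => hi.
by apply: h; exists i.
Qed.

(** A witness [L] for height at least [s] must contain [core t s], and a monochrome core is itself a
    witness. *)
Lemma le_height j i t s : simplex [set: E]%SET t -> 0 < s -> s <= 1 ->
  (s <= height j i t) = monochrome j i (core t s).
Proof.
move=> st s0 s1; apply/bigmax_geP/idP => [[|[L /andP[L0 mL]]]|mc].
- by move=> /(lt_le_trans s0); rewrite ltxx.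
- case/bigmin_geP => _ H; apply: monochromeS mL.
  apply/fintype.subsetP => e; rewrite inE; apply: contraTT => /H.
  by rewrite -leNgt.
- right; exists (core t s); first by rewrite core_neq0.
  apply/bigmin_geP; split=> // e; rewrite inE.
  by rewrite -leNgt.
Qed.

(** At the smaller of the two heights the core is one nonempty face, which cannot have two
    colours. *)
Lemma height_gt0_inj j i i' t : simplex [set: E]%SET t ->
  0 < height j i t -> 0 < height j i' t -> i = i'.
Proof.
move=> st hi hi'; pose s := Num.min (height j i t) (height j i' t).
have s0 : 0 < s by rewrite lt_min hi hi'.
have s1 : s <= 1 by rewrite ge_min height_le1.
have c0 := core_neq0 st s0.
have : s <= height j i t by rewrite ge_min lexx.
rewrite le_height // => /(monochrome_color c0) ->.
have : s <= height j i' t by rewrite ge_min lexx orbT.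
by rewrite le_height // => /(monochrome_color c0).
Qed.

Lemma simplexS F F' : F \subset F' -> simplex F `<=` simplex F'.
Proof.
move=> FF t [t0 [tF t1]]; split=> //; split=> // e eF; apply: tF.
by apply: contra eF => /(fintype.subsetP FF).
Qed.

Lemma core_sub F t s : simplex F t -> s <= 1 -> core t s \subset F.
Proof.
move=> [_ [tF _]] s1; apply/fintype.subsetP => e; rewrite inE; apply: contraTT => eF.
by rewrite -leNgt /slack tF // mulr0 subr0 le_max s1 orbT.
Qed.

(** The core at a level at most 1 lies in [F], so both colourings agree on its subfaces. *)
Lemma height_local F j j' i t : simplex F t -> {in faces F, j =1 j'} ->
  height j i t = height j' i t.
Proof.
move=> sF.
have st : simplex [set: E]%SET t := simplexS (finset.subsetT F) sF.
suff H j1 j2 : {in faces F, j1 =1 j2} -> height j1 i t <= height j2 i t.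
  by move=> jj; apply: le_anti; rewrite !H // => B BF; rewrite jj.
move=> jj; have := height_ge0 j1 i t.
rewrite le_eqVlt => /predU1P[<-|h0]; first exact: height_ge0.
rewrite le_height ?height_le1 //; apply/forall_inP => B Bc.
rewrite -jj; last first.
  move: Bc; rewrite !mem_faces => /andP[-> Bc] /=.
  by apply: fintype.subset_trans Bc _; rewrite core_sub // height_le1.
move: B Bc; apply/forall_inP.
by have := lexx (height j1 i t); rewrite {1}le_height ?height_le1.
Qed.

Variable eps : I -> int.
Hypothesis eps_sum1 : \sum_i eps i = 1.
Hypothesis eps_sqr : forall i, eps i ^+ 2 = 1.

Lemma sum_weight_height_ge i t s : simplex [set: E]%SET t -> 0 < s -> s <= 1 ->
  \sum_(j | s <= height j i t) weight eps j = eps i.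
Proof.
move=> st s0 s1.
rewrite -[RHS](weight_constant (P := faces (core t s)) eps_sum1) //; last first.
  by rewrite odd_card_faces ?core_neq0.
rewrite big_mkcond /=; apply: eq_bigr => j _; rewrite le_height // /monochrome.
by case: ifP; rewrite ?mulr1 ?mulr0.
Qed.

(* [sum_weight_height_ge] leaves no mass on heights strictly between 0 and 1. *)
Lemma sum_weight_height i t (G : RR -> int) : simplex [set: E]%SET t ->
  \sum_j weight eps j * G (height j i t) = G 0 + eps i * (G 1 - G 0).
Proof.
move=> st.
(* [K] is [G] corrected to vanish at 0 and 1, so only intermediate heights can contribute to its
   sum. *)
pose K (s : RR) := G s - G 0 - (if s == 1 then G 1 - G 0 else 0).
have K0 : K 0 = 0 by rewrite /K subrr eq_sym oner_eq0 subr0.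
have K1 : K 1 = 0 by rewrite /K eqxx subrr.
have : \sum_j weight eps j * K (height j i t) = 0.
  apply: sum_fibers_eq0 => j0 Kj0; set s := height j0 i t.
  have s0 : 0 < s.
    rewrite lt_neqAle height_ge0 andbT; apply: contraNneq Kj0.
    by rewrite -/s => <-; rewrite K0.
  have s1 : s < 1.
    rewrite lt_neqAle height_le1 andbT; apply: contraNneq Kj0.
    by rewrite -/s => ->; rewrite K1.
  (* The next attained height above [s], or 1 if there is none; height exactly [s] then has weight
     [eps i - eps i]. *)
  pose s' : RR := \big[Num.min/1]_(j | s < height j i t) height j i t.
  have ss' : s < s' by apply/bigmin_gtP; split.
  have s'1 : s' <= 1 by apply/bigmin_leP; left.
  have := sum_weight_height_ge i st s0 (ltW s1).
  rewrite (bigID (fun j => height j i t == s)) /=.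
  rewrite [X in _ + X](eq_bigl (fun j => s' <= height j i t)); last first.
    move=> j /=; rewrite andbC eq_sym -lt_neqAle; apply/idP/idP => [sj|].
      by apply/bigmin_leP; right; exists j.
    exact: lt_le_trans.
  rewrite sum_weight_height_ge ?(lt_trans s0) // => /(canRL (addrK _)).
  rewrite subrr => {2}<-; apply: eq_bigl => j.
  by case: eqP => [->|]; rewrite ?lexx ?andbF.
under eq_bigr do rewrite /K !mulrBr.
rewrite !sumrB -!big_distrl /= weight_sum1 // mul1r => /eqP.
rewrite subr_eq0 subr_eq => /eqP ->; rewrite addrC; congr (_ + _).
rewrite -(sum_weight_height_ge i st ltr01 (lexx 1)) big_distrl /=.
rewrite [RHS]big_mkcond /=; apply: eq_bigr => j _.
by rewrite eq_le height_le1 /=; case: ifP; rewrite ?mulr0.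
Qed.

Lemma height_continuous j i : continuous (height j i).
Proof.
apply: continuous_bigmax => L; apply: continuous_bigmin => e.
move=> t; apply: (@continuous_max RR (Pt E)); first exact: cvg_cst.
apply: cvgB; first exact: cvg_cst.
apply: cvgM; first exact: cvg_cst.
exact: (@proj_continuous E (fun=> RR) e t).
Qed.

End Height.

(** * Maps from the simplex to the star of paths *)

Section StarMap.
Variables (E I : finType) (M : topologicalType) (a : M) (H : I -> RR -> M).
Hypothesis H0 : forall i, H i 0 = a.
Implicit Types (j : {ffun {set E} -> I}) (t : Pt E).

(** On the simplex at most one height is positive, so the choice of branch is forced; [a] is the
    root. *)
Definition star_map j t : M :=
  if [pick i | 0 < height j i t] is Some i then H i (height j i t) else a.

Lemma star_mapE j i t : simplex [set: E]%SET t -> 0 < height j i t ->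
  star_map j t = H i (height j i t).
Proof.
move=> st hi; rewrite /star_map; case: pickP => [i' hi'|/(_ i)].
  by rewrite (height_gt0_inj st hi' hi).
by rewrite hi.
Qed.

Lemma star_mapP j t : exists i, star_map j t = H i (height j i t).
Proof.
rewrite /star_map; case: pickP => [i _|h]; first by exists i.
(* All heights vanish, so any branch will do; [j finset.set0] only supplies an element of [I]. *)
exists (j finset.set0); rewrite -[LHS](H0 (j finset.set0)); congr H.
by apply/le_anti; rewrite height_ge0 leNgt h.
Qed.

Lemma star_map_eq0 j t : (forall i, height j i t = 0) -> star_map j t = a.
Proof. by move=> h; have [i ->] := star_mapP j t; rewrite h. Qed.

Lemma star_map_local F j j' t : simplex F t -> {in faces F, j =1 j'} ->
  star_map j t = star_map j' t.
Proof.
move=> sF jj; rewrite /star_map.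
rewrite (@eq_pick _ _ (fun i => 0 < height j' i t)); last first.
  by move=> i; rewrite (height_local _ sF jj).
by case: pickP => // i _; rewrite (height_local _ sF jj).
Qed.

Lemma star_map_continuous j : (forall i, continuous (H i)) ->
  {within simplex [set: E]%SET, continuous (star_map j)}.
Proof.
move=> cH; apply/subspace_continuousP => t st N.
change (nbhs (star_map j t) N ->
  \forall t' \near t, simplex [set: E]%SET t' -> N (star_map j t')).
have cHh i : H i (height j i t') @[t' --> t] --> H i (height j i t).
  apply: (cvg_comp (height j i) (H i)) (cH i _).
  exact: height_continuous.
(* A branch with positive height keeps it nearby; at the root, all of the finitely many branches
   stay near [a] together. *)
have [[i hi]|h0] := pselect (exists i, 0 < height j i t).
  rewrite (star_mapE st hi) => /cHh nN.
  have nh : \forall t' \near t, 0 < height j i t'.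
    have : \forall s \near height j i t, 0 < s by exact: lt_nbhsr.
    exact: height_continuous.
  have {}nN : \forall t' \near t, N (H i (height j i t')) := nN.
  by apply: filterS2 nN nh => t' Nt' ht' st'; rewrite (star_mapE st' ht').
have ha := height_eq0 h0.
rewrite star_map_eq0 // => Na.
have : \forall t' \near t, forall i, N (H i (height j i t')).
  apply: (filter_forall (nbhs_filter t)) => i.
  by apply: (cHh i); rewrite ha H0.
apply: filterS => t' nt' _ /=.
by have [i ->] := star_mapP j t'.
Qed.

Variable eps : I -> int.
Hypothesis eps_sum1 : \sum_i eps i = 1.
Hypothesis eps_sqr : forall i, eps i ^+ 2 = 1.

Lemma sum_weight_star_map (g : M -> int) t : simplex [set: E]%SET t ->
  \sum_j weight eps j * g (star_map j t) = \sum_i eps i * g (H i 1).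
Proof.
move=> st.
(* At most one increment is nonzero, so [g] of the map is additive over the branches and each branch
   can be summed separately. *)
have gE j : g (star_map j t) = g a + \sum_i (g (H i (height j i t)) - g a).
  have [[i hi]|/height_eq0 h0] := pselect (exists i, 0 < height j i t).
    rewrite (star_mapE st hi) (bigD1 i) //= big1 ?addr0 => [|i' ii'].
      by rewrite addrC subrK.
    suff -> : height j i' t = 0 by rewrite H0 subrr.
    apply/le_anti; rewrite height_ge0 andbT leNgt; apply: contra ii' => hi'.
    by rewrite (height_gt0_inj st hi' hi).
  rewrite star_map_eq0 // big1 ?addr0 // => i _.
  by rewrite h0 H0 subrr.
under eq_bigr do rewrite gE mulrDr big_distrr /=.
rewrite big_split /= -big_distrl /= weight_sum1 // mul1r exchange_big /=.
under eq_bigr => i _.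
  rewrite (sum_weight_height eps_sum1 eps_sqr i (fun s => g (H i s) - g a) st).
  rewrite H0 subrr add0r subr0 mulrBr; over.
by rewrite sumrB -big_distrl /= eps_sum1 mul1r addrC subrK.
Qed.

End StarMap.

(** * Finite combinations of maps and their pushforwards *)

Section Combination.
Variables (J : finType) (W : choiceType) (c : J -> int) (w : J -> W).

Definition combination : W -> int := fun v => \sum_j c j * Defs.basis (w j) v.

Lemma combination_neq0 v : combination v != 0 -> exists j, v = w j.
Proof.
move=> v0; apply: contrapT => h; move/negP: v0; apply; apply/eqP.
rewrite /combination big1 // => j _; rewrite /Defs.basis; case: eqP => [vj|_].
  by case: h; exists j.
by rewrite mulr0.
Qed.

Lemma ens_combination : ens combination.
Proof.
apply: (@sub_finite_set _ _ (range w)); last first.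
  by apply: finite_image; exact: finite_finset.
by move=> v /combination_neq0[j ->]; exists j.
Qed.

End Combination.

Lemma push_combination (J : finType) (W W' : choiceType) (c : J -> int)
    (w : J -> W) (f : W -> W') :
  push f (combination c w) = combination c (f \o w).
Proof.
apply/funext => v; rewrite /push.
pose s := undup [seq w j | j <- enum J & f (w j) == v].
rewrite -(fsbig_widen [set` s]) => [|u /=|u /= [fu us]].
- rewrite -fsbig_seq ?undup_uniq // /combination exchange_big /=.
  apply: eq_bigr => j _; rewrite -big_distrr /=; congr (_ * _).
  rewrite /Defs.basis /=; case: eqP => [fj|fj].
    have js : w j \in s by rewrite mem_undup map_f // mem_filter fj eqxx mem_enum.
    rewrite (bigD1_seq (w j)) ?undup_uniq //= eqxx big1 ?addr0 // => u.
    by move/negPf => ->.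
  rewrite big_seq big1 // => u; rewrite mem_undup => /mapP[k].
  rewrite mem_filter => /andP[/eqP fk _] uk; case: eqP => // uj.
  by case: fj; rewrite -uj uk.
- rewrite mem_undup => /mapP[j]; rewrite mem_filter => /andP[/eqP fj _] ->.
  exact: fj.
- apply/eqP/negPn/negP => /combination_neq0[j uj]; apply: us.
  rewrite mem_undup uj map_f // mem_filter mem_enum andbT.
  by rewrite -uj fu.
Qed.

(** * Fissility from independent colours on disjoint faces *)

Section Fissile.
Variables (X Y : topologicalType) (y0 : Y) (E : finType).
Implicit Types (F : {set E}) (A : {set {set E}}) (u : Pt E -> X -> Y).
Implicit Types (tau : {set E} -> Pt E -> X -> Y).

Lemma simplex_meet F G t : simplex F t -> simplex G t ->
  exists2 e, e \in F & e \in G.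
Proof.
move=> [_ [tF t1]] [_ [tG _]]; apply: contrapT => h.
move: t1; rewrite big1 => [/eqP|e _]; first by rewrite eq_sym oner_eq0.
have [eF|eF] := boolP (e \in F); last exact: tF.
by apply: tG; apply/negP => eG; apply: h; exists e.
Qed.

Lemma layout_simplex A F G t : layout A -> F \in A -> G \in A ->
  simplex F t -> simplex G t -> F = G.
Proof.
move=> [_ dA] FA GA tF tG; apply: contrapT => /eqP FG.
have [e eF eG] := simplex_meet tF tG.
by move: (dA F G FA GA FG e eF); rewrite eG.
Qed.

Lemma restrUK (U U' : set (Pt E)) u : U `<=` U' ->
  restrU y0 U (restrU y0 U' u) = restrU y0 U u.
Proof.
move=> UU; apply/funext => t; rewrite /restrU.
by case: asboolP => // Ut; rewrite asboolT //; exact: UU.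
Qed.

Lemma glueE A tau F t : layout A -> F \in A -> simplex F t ->
  Defs.glue y0 A tau t = tau F t.
Proof.
move=> lA FA tF; rewrite /Defs.glue; case: pickP => [G /andP[GA /asboolP tG]|/(_ F)].
  by rewrite (layout_simplex lA FA GA tF tG).
by rewrite FA asboolT.
Qed.

Lemma glue_out A tau t : ~ DeltaL A t -> Defs.glue y0 A tau t = @cst0 X Y y0.
Proof.
move=> nt; rewrite /Defs.glue; case: pickP => // G /andP[GA /asboolP tG].
by case: nt; exists G.
Qed.

(** A family with nonzero product consists of maps supported on their own disjoint faces, so gluing
    determines it: each member is a restriction of [u]. *)
Lemma combineE A (V : {set E} -> (Pt E -> X -> Y) -> int) u : layout A ->
  (forall F v, V F v != 0 -> v = restrU y0 (simplex F) v) ->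
  combine y0 A V u =
  if `[< u = restrU y0 (DeltaL A) u >] then
    \prod_(F in A) V F (restrU y0 (simplex F) u)
  else 0.
Proof.
move=> lA HV; rewrite /combine.
case: asboolP => [uA|uA]; last first.
  apply: fsbig1 => tau [_ gu]; case: uA.
  rewrite -gu; apply/funext => t; rewrite /restrU; case: asboolP => // tA.
  by rewrite glue_out.
pose tau0 F := if F \in A then restrU y0 (simplex F) u else fun=> @cst0 X Y y0.
rewrite -(fsbig_widen [set tau0]).
- rewrite fsbig_set1; apply: eq_bigr => F FA.
  by rewrite /tau0 FA.
- move=> _ ->; split=> [F /negPf FA|]; first by rewrite /tau0 FA.
  apply/funext => t; rewrite [RHS](congr1 (@^~ t) uA) /restrU.
  case: asboolP => [[F FA tF]|]; last exact: glue_out.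
  by rewrite (glueE _ lA FA tF) /tau0 FA /restrU asboolT.
- move=> tau [[tauA gu] tau0P] /=; apply/eqP/negPn/negP => p0; apply: tau0P.
  apply/funext => F; rewrite /tau0; case: ifPn => [FA|]; last exact: tauA.
  have /HV -> : V F (tau F) != 0 by move/prodf_neq0: p0; apply.
  rewrite -gu; apply/funext => t; rewrite /restrU; case: asboolP => // tF.
  by rewrite (glueE _ lA FA tF).
Qed.

Variables (I : finType) (eps : I -> int).
Hypothesis eps_sum1 : \sum_i eps i = 1.

Lemma fissile_combination (w : {ffun {set E} -> I} -> Pt E -> X -> Y) :
  (forall F (j j' : {ffun {set E} -> I}) t,
     simplex F t -> {in faces F, j =1 j'} -> w j t = w j' t) ->
  fissile y0 (combination (weight eps) w).
Proof.
move=> wl A lA; apply/funext => u.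
rewrite combineE => // [|F v]; last first.
  rewrite push_combination => /combination_neq0[j ->] /=.
  by rewrite restrUK.
rewrite push_combination.
(* Two maps agree on a union of faces exactly when they agree on each face, so the indicator is a
   product. *)
transitivity (\sum_j weight eps j *
   (if `[< u = restrU y0 (DeltaL A) u >] then
   \prod_(F <- enum A)
     Defs.basis (restrU y0 (simplex F) (w j)) (restrU y0 (simplex F) u) else 0)).
  apply: eq_bigr => j _; congr (_ * _); rewrite /Defs.basis /=.
  case: asboolP => uA; last first.
    by case: eqP => // uj; case: uA; rewrite uj restrUK.
  case: eqP => [uj|uj].
    rewrite big_seq big1 // => F; rewrite mem_enum => FA.
    by rewrite uj restrUK ?eqxx // => t tF; exists F.
  apply/esym/eqP; rewrite prodf_seq_eq0; apply/hasP.
  apply: contrapT => h; apply: uj; rewrite uA.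
  apply/funext => t; rewrite /restrU; case: asboolP => // -[F FA tF].
  have : restrU y0 (simplex F) u = restrU y0 (simplex F) (w j).
    apply: contrapT => /eqP nF; apply: h; exists F; first by rewrite mem_enum.
    by rewrite /= (negPf nF).
  by move=> /(congr1 (@^~ t)); rewrite /restrU asboolT.
case: asboolP => _; last by rewrite big1 // => j _; rewrite mulr0.
(* Disjoint faces share no nonempty subface, so the factors depend on disjoint sets of colours. *)
rewrite (@weight_indep_prod _ _ _ eps_sum1 _ _ (fun F => mem (faces F))).
- rewrite -[RHS]big_enum /=; apply: eq_bigr => F _.
  by rewrite push_combination.
- exact: enum_uniq.
- move=> F G; rewrite !mem_enum => FA GA FG B; rewrite /= !mem_faces.
  move=> /andP[/set0Pn[e eB] /fintype.subsetP BF].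
  apply/negP => /andP[_ /fintype.subsetP BG].
  by have := lA.2 F G FA GA FG e (BF _ eB); rewrite BG.
- move=> F j j' jj; congr (Defs.basis _ _); apply/funext => t; rewrite /restrU.
  by case: asboolP => // tF; exact: wl tF jj.
Qed.

End Fissile.

(** * Signed families of maps from 1-similarity *)

Lemma sum_option (J : finType) (F : option J -> int) :
  \sum_o F o = F None + \sum_j F (Some j).
Proof.
rewrite (bigD1 None) //=; congr (_ + _).
rewrite (reindex_omap Some id) /= => [|[j|]] //.
by apply: eq_bigl => j; rewrite eqxx.
Qed.

Lemma push_basis_sub (J : finType) (W W' : choiceType) (c : J -> int)
    (w : J -> W) (b : W) (f : W -> W') :
  push f (fun v => Defs.basis b v - combination c w v) =
  fun v => Defs.basis (f b) v - combination c (f \o w) v.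
Proof.
have -> : (fun v => Defs.basis b v - combination c w v) =
    combination (oapp (fun j => - c j) 1) (oapp w b).
  apply/funext => v; rewrite /combination sum_option /= mul1r; congr (_ + _).
  by rewrite -sumrN; apply: eq_bigr => j _; rewrite mulNr.
rewrite push_combination; apply/funext => v.
rewrite /combination sum_option /= mul1r; congr (_ + _).
by rewrite -sumrN; apply: eq_bigr => j _; rewrite mulNr.
Qed.

Lemma ens_signed (W : choiceType) (A : W -> int) : ens A ->
  exists n (eps : 'I_n -> int) (w : 'I_n -> W),
    [/\ forall i, eps i ^+ 2 = 1, forall i, supp A (w i) & A = combination eps w].
Proof.
move=> fA; pose s := finmap.enum_fset (fset_set (supp A)).
have sP v : v \in s = (A v != 0).
  by rewrite in_fset_set //; apply/asboolP/idP.
have us : uniq s by exact: finmap.fset_uniq.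
(* Each [v] is repeated [|A v|] times with the sign of [A v], so every coefficient has square 1. *)
pose l := flatten [seq nseq `|A v|%N (v, sgz (A v)) | v <- s].
have lP p : p \in l -> A p.1 != 0 /\ p.2 = sgz (A p.1).
  move=> /flattenP[_ /mapP[v vs ->]]; rewrite mem_nseq => /andP[_ /eqP ->] /=.
  by rewrite -sP vs.
exists (size l), (fun i => (tnth (in_tuple l) i).2),
  (fun i => (tnth (in_tuple l) i).1).
split=> [i|i|].
- have [Ai ->] := lP _ (mem_tnth i (in_tuple l)).
  by rewrite -[LHS]/(_ * _) mulz_sg Ai.
- by have [] := lP _ (mem_tnth i (in_tuple l)).
- apply/funext => v; rewrite /combination.
  rewrite -(big_tnth _ _ l xpredT (fun p : W * int => p.2 * Defs.basis p.1 v)).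
  rewrite big_flatten /= big_map /=.
  under eq_bigr do rewrite big_nseq iter_addr_0 /=.
  rewrite /Defs.basis; have [vs|vs] := boolP (v \in s).
    rewrite (bigD1_seq v) //= eqxx mulr1 big1 ?addr0.
      by rewrite -mulr_natr natz abszEsg mulrA mulz_sg -sP vs mul1r.
    by move=> u /negPf uv; rewrite eq_sym uv mulr0 mul0rn.
  rewrite big_seq big1 => [|u us']; last first.
    by case: eqP vs => [->|]; rewrite ?us' // mulr0 mul0rn.
  by move: vs; rewrite sP negbK => /eqP.
Qed.

(** The set [{x0, x}] sees a based map only through its value at [x]; the ensemble relation there
    becomes one between values, which any [g] preserves. *)
Lemma rsim1_signed (X Y : topologicalType) (x0 : X) (y0 : Y) (a b : X -> Y) :
  b x0 = y0 -> rsim x0 y0 1 a b ->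
  exists n (eps : 'I_n -> int) (w : 'I_n -> X -> Y),
    [/\ forall i, eps i ^+ 2 = 1, forall i, path_comp x0 y0 a (w i) &
        forall x (g : Y -> int), \sum_i eps i * g (w i x) = g (b x)].
Proof.
move=> b0 [A [/ens_signed[n [eps [w [e2 wA AE]]]] sA fA]]; rewrite AE in fA.
exists n, eps, w; have pw i : path_comp x0 y0 a (w i) by apply: sA; exact: wA.
split=> // x g.
have w0 i : w i x0 = y0.
  have [h [_ [_ [<- hb]]]] := pw i; have [] := hb 1; by rewrite // ler01 lexx.
pose v (o : option 'I_n) : X -> Y := oapp w b o.
have v0 o : v o x0 = y0 by case: o.
pose Rs : set X := [set x0; x].
have FR : Fset x0 2 Rs.
  split; first by left.
  exists (fun i : 'I_2 => if i == ord0 then x0 else x).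
  by move=> _ [->|->]; [exists ord0|exists ord_max].
have restrE o o' : (restr y0 Rs (v o) == restr y0 Rs (v o')) = (v o x == v o' x).
  apply/eqP/eqP => [/(congr1 (@^~ x))|vv].
    by rewrite /restr asboolT //; right.
  apply/funext => z; rewrite /restr; case: asboolP => // -[->|->] //.
  by rewrite !v0.
(* [None] stands for [b] with coefficient 1; each fibre of the values at [x] has total 0 because the
   pushed ensemble vanishes. *)
have : \sum_o oapp (fun i => - eps i) 1 o * g (v o x) = 0.
  apply: sum_fibers_eq0 => o _.
  have := congr1 (@^~ (restr y0 Rs (v o))) (fA _ FR).
  rewrite push_basis_sub /= => fx; rewrite -[RHS]fx.
  rewrite big_mkcond sum_option /=; congr (_ + _).
    by rewrite /Defs.basis -(restrE None) eq_sym.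
  rewrite /combination -sumrN; apply: eq_bigr => i _.
  rewrite /Defs.basis -(restrE (Some i)) eq_sym /=.
  by case: eqP; rewrite ?mulr1 ?mulr0 ?oppr0.
rewrite sum_option /= mul1r => /eqP; rewrite addr_eq0 => /eqP ->.
by rewrite -sumrN; apply: eq_bigr => i _; rewrite mulNr opprK.
Qed.

(** * Extending paths from the unit interval to the line *)

Section Clamp.
Variable M : topologicalType.

(** Precomposing with this retraction makes a path continuous on the whole line, as
    [star_map_continuous] requires. *)
Definition clamp (s : RR) : RR := Num.max 0 (Num.min 1 s).

Lemma clamp_itv s : 0 <= clamp s <= 1.
Proof. by rewrite le_max lexx /= ge_max ler01 ge_min lexx. Qed.

Lemma clamp_id s : 0 <= s <= 1 -> clamp s = s.
Proof. by case/andP=> s0 s1; rewrite /clamp (min_idPr s1) (max_idPr s0). Qed.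

Lemma clamp_continuous : continuous clamp.
Proof.
move=> s; apply: (@continuous_max RR RR); first exact: cvg_cst.
by apply: (@continuous_min RR RR); [exact: cvg_cst|exact: cvg_id].
Qed.

Lemma continuous_comp_clamp (g : RR -> M) :
  {within [set t : RR | 0 <= t <= 1], continuous g} -> continuous (g \o clamp).
Proof.
move=> /subspace_continuousP cg s N Ns.
have /cg := clamp_itv s => /(_ N Ns) nN.
have {}nN : \forall t \near clamp s, 0 <= t <= 1 -> N (g t) := nN.
have {}nN : \forall t \near s, 0 <= clamp t <= 1 -> N (g (clamp t)) :=
  clamp_continuous nN.
change (\forall t \near s, N (g (clamp t))).
by apply: filterS nN => t; apply; exact: clamp_itv.
Qed.

End Clamp.

(** * Two-point subsets of the wreath product *)

Section Wreath.
Variables (X Y : topologicalType) (x0 : X) (y0 : Y) (E : finType).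

Lemma simplex_neq0 : (0 < #|E|)%N -> exists t : Pt E, simplex [set: E]%SET t.
Proof.
case/card_gt0P => e0 _; exists (fun e => (e == e0)%:R); split.
  by move=> e; rewrite ler0n.
split=> [e|]; first by rewrite inE.
by rewrite (bigD1 e0) //= eqxx big1 ?addr0 // => e /negPf ->.
Qed.

Lemma ord2_eq (i k l : 'I_2) : i != k -> i != l -> k = l.
Proof.
by case: i k l => [[|[|?]] ?] [[|[|?]] ?] [[|[|?]] ?] //= *; apply/val_inj.
Qed.

(** Besides the base class, [Rs] has room for at most one point [(t, x)], so the restriction is a
    function of [w t x] alone. *)
Lemma restr_wr_two (Rs : set (set (Pt E * X))) : (0 < #|E|)%N ->
  Rs `<=` wr_pts x0 (E := E) -> Rs (wr_base x0 (E := E)) -> Defs.card_le Rs 2 ->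
  exists t x (f : Y -> set (Pt E * X) -> Y), simplex [set: E]%SET t /\
    forall w : Pt E -> X -> Y,
      (forall t', simplex [set: E]%SET t' -> w t' x0 = y0) ->
      restr_wr y0 Rs (sharp x0 w) = f (w t x).
Proof.
move=> E0 Rp Rb [h Rh]; have [t0 st0] := simplex_neq0 E0.
(* [xget] may pick any representative of the base class, hence the condition on [w] at every [t'] of
   the simplex. *)
have sharp0 (w : Pt E -> X -> Y) :
    (forall t', simplex [set: E]%SET t' -> w t' x0 = y0) ->
    sharp x0 w (wr_base x0 (E := E)) = y0.
  move=> w0; rewrite /sharp; set p := xget _ _.
  have [st ->] : wr_base x0 (E := E) p by apply: xgetPex; exists (t0, x0).
  exact: w0.
have [[C [RC C0]]|h0] :=
  pselect (exists C, Rs C /\ C <> wr_base x0 (E := E)); last first.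
  exists t0, x0, (fun _ _ => y0); split=> // w w0; apply/funext => C.
  rewrite /restr_wr; case: asboolP => // RC.
  suff -> : C = wr_base x0 (E := E) by exact: sharp0.
  by apply: contrapT => C0; apply: h0; exists C.
have [[t x] /= [st _] pC] := Rp _ RC.
have xx0 : x <> x0.
  by move=> xx0; apply: C0; rewrite -pC /wr_class asboolT.
have {}pC : C = [set (t, x)] by rewrite -pC /wr_class asboolF.
exists t, x, (fun y C' => if `[< Rs C' >] then
  if `[< C' = wr_base x0 (E := E) >] then y0 else y else y0); split=> // w w0.
apply/funext => C'; rewrite /restr_wr; case: asboolP => // RC'.
case: asboolP => [->|C'0]; first exact: sharp0.
suff -> : C' = C.
  rewrite /sharp; set p := xget _ _.
  have : C p by apply: xgetPex; exists (t, x); rewrite pC.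
  by rewrite pC => ->.
have [i0 _ hi0] := Rh _ Rb; have [i1 _ hi1] := Rh _ RC.
have [i2 _ hi2] := Rh _ RC'.
rewrite -hi1 -hi2; congr h; apply: (@ord2_eq i0); apply/eqP => ii.
  by apply: C'0; rewrite -hi2 -ii.
by apply: C0; rewrite -hi1 -ii.
Qed.

End Wreath.

(** * From 1-similarity to a fissile ensemble of star maps *)

Theorem theorem14p2 (X Y : topologicalType) (x0 : X) (y0 : Y)
  (cellX : cellular x0) (cellY : cellular y0) (compX : compact [set: X])
  (a b : X -> Y) (Ha : based_maps x0 y0 a) (Hb : based_maps x0 y0 b) :
  rsim x0 y0 1 a b -> strong_sim x0 y0 1 a b.
Proof.
move=> /(rsim1_signed Hb.2)[n [eps [w [e2 pw wb]]]] E E0.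
have eps_sum1 : \sum_i eps i = 1.
  by rewrite -[RHS](wb x0 (fun=> 1)); apply: eq_bigr => i _; rewrite mulr1.
have [h hP] := choice pw.
pose H i (s : RR) : {compact-open, X -> Y} := h i (clamp s).
have cH i : continuous (H i) by apply: continuous_comp_clamp; case: (hP i).
have H0 i : H i 0 = a.
  by rewrite /H clamp_id ?lexx ?ler01 //; case: (hP i) => _ [].
have H1 i : H i 1 = w i.
  by rewrite /H clamp_id ?lexx ?ler01 //; case: (hP i) => _ [_ []].
have bH i s : based_maps x0 y0 (H i s).
  by case: (hP i) => _ [_ [_]]; apply; exact: clamp_itv.
(* The star is mapped to Y^X with root [a], branches [H i] and leaves [w i]. *)
pose W (j : {ffun {set E} -> 'I_n}) : Pt E -> X -> Y :=
  restrU y0 (simplex [set: E]%SET) (star_map (a : {compact-open, X -> Y}) H j).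
have WE j t : simplex [set: E]%SET t ->
    W j t = star_map (a : {compact-open, X -> Y}) H j t.
  by move=> st; rewrite /W /restrU asboolT.
exists (combination (weight eps) W); split.
- exact: ens_combination.
- move=> _ /combination_neq0[j ->]; split; last split.
  + apply: (@subspace_eq_continuous _ _ {compact-open, X -> Y}
      (star_map (a : {compact-open, X -> Y}) H j)); last first.
      exact: (star_map_continuous H0 cH).
    by move=> t /set_mem st; rewrite [RHS]WE.
  + move=> _ [t st <-]; rewrite WE //; have [i ->] := star_mapP H0 j t.
    set s := height j i t.
    (* Sliding along branch [i] from the root to height [s] joins [a] to the value at [t]. *)
    exists (fun r => H i (s * r)); rewrite mulr0 mulr1; split; last by split.
    apply: continuous_subspaceT => r; apply: (cvg_comp _ (H i)) (cH i _).
    apply: cvgM; [exact: cvg_cst|exact: cvg_id].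
  + by move=> t st; rewrite /W /restrU asboolF.
- apply: fissile_combination => // F j j' t sF jj.
  by rewrite /W /restrU (star_map_local _ _ sF jj).
- move=> Rs Rp Rb R2; rewrite push_basis_sub; apply/funext => v.
  have [t [x [f [st fP]]]] := restr_wr_two y0 E0 Rp Rb R2.
  rewrite fP; last by move=> t' st'; rewrite /Xi /restrU asboolT //; exact: Hb.2.
  rewrite /Xi /restrU asboolT //; apply/eqP; rewrite subr_eq0; apply/eqP.
  (* The test function is the indicator of [v] after [f]: its weighted sum over the leaves equals
     its value at [b x]. *)
  rewrite -(wb x (fun y => Defs.basis (f y) v)).
  under eq_bigr do rewrite -H1.
  rewrite -(sum_weight_star_map H0 eps_sum1 e2 (fun m => Defs.basis (f (m x)) v) st).
  apply: eq_bigr => j _; rewrite /= fP ?WE // => t' st'; rewrite WE //.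
  by have [i ->] := star_mapP H0 j t'; case: (bH i (height j i t')).
Qed.
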